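(* The partition function $$Z_{\tilde\hbar}(\mathcal{M}(D,\mathbb{C}^{\ell+1}),\beta,\underline{\lambda})=\mathrm{Tr}_{\mathcal{H}^{(\ell+1)}}\,e^{-\frac{\beta}{\tilde\hbar}\left(\hbar\hat H_0+\sum_{j=1}^{\ell+1}\lambda_j\hat H_j\right)},\qquad \underline{\lambda}=(\lambda_1,\dots,\lambda_{\ell+1}),$$ satisfies the identity $$Z_{\tilde\hbar}(\mathcal{M}(D,\mathbb{C}^{\ell+1}),\beta,\underline{\lambda})=\prod_{j=1}^{\ell+1}\Gamma_q(t_j),$$ where $q=e^{-\beta\hbar}$, $t_j=e^{-\beta\lambda_j}$, and the $q$-version of the $\Gamma$-function is given by $$\Gamma_q(t)=\prod_{k=0}^{+\infty}\frac{1}{1-tq^k}.$$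
   Context: $\mathcal{M}(D,\mathbb{C}^{\ell+1})$ denotes the space of holomorphic maps of the disk $D=\{z\in\mathbb{C}:|z|\le1\}$ to $\mathbb{C}^{\ell+1}$. Its quantization, with quantum deformation parameter $\tilde\hbar$, has the state space $\mathcal{H}^{(\ell+1)}=\mathbb{C}[\varphi^j_n:\ n\ge0,\ 1\le j\le\ell+1]$, the space of polynomials in the variables $\varphi^j_n$; here $\varphi^j_n$ corresponds to the $n$-th Fourier coefficient of the boundary value of the $j$-th component of the map. The operators $\hat H_0$ and $\hat H_j$ (quantized momenta for rotations of $D$ and for the diagonal torus $(U_1)^{\ell+1}\subset U_{\ell+1}$ acting on $\mathbb{C}^{\ell+1}$) are $$\hat H_0=\tilde\hbar\sum_{j=1}^{\ell+1}\sum_{n=0}^\infty n\,\varphi^j_n\frac{\partial}{\partial\varphi^j_n},\qquad \hat H_j=\tilde\hbar\sum_{n=0}^\infty\varphi^j_n\frac{\partial}{\partial\varphi^j_n},\qquad j=1,\dots,\ell+1.$$ The parameter $\hbar$ is a generator of the Lie algebra of the rotation group $S^1$, $\underline{\lambda}$ is an element of the Cartan subalgebra of $\mathfrak{u}_{\ell+1}=\mathrm{Lie}(U_{\ell+1})$, and $\beta$ is a parameter. The operators are diagonal in the basis of monomials, over which the trace is taken. *)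

(* Defs.v *)
From HB Require Import structures.
From mathcomp Require Import all_boot all_order all_algebra finmap.
From mathcomp Require Import all_classical all_reals all_analysis.
From mathcomp Require Import complex.
From mathcomp Require Import summability.
(* The notations of monalg clash with those of mathcomp-analysis. *)
From mathcomp Require Import -(notations) monalg.

Set Implicit Arguments.
Unset Strict Implicit.
Unset Printing Implicit Defensive.

Import Order.TTheory GRing.Theory Num.Theory.
Import numFieldNormedType.Exports.

Local Open Scope classical_set_scope.
Local Open Scope ring_scope.
Local Open Scope complex_scope.

(* Limits of complex numbers are taken in [R[i]^o], which carries the topology
   given by the modulus. *)

Definition expC (R : realType) (z : R[i]) : R[i] :=
  (expR (complex.Re z))%:C *
  (cos (complex.Im z) +i* sin (complex.Im z)).

Section StateSpace.
Variables (R : realType) (l : nat).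

(* The pair [(j, n)] indexes the variable varphi^j_n; the components j, usually
   numbered from 1 to l+1, are the elements of ['I_l.+1]. *)
Definition var_index : choiceType := ('I_l.+1 * nat)%type.

Definition monom : choiceType := cmonom var_index.

(* The ring C[varphi^j_n], realised as the monoid algebra over C of the free
   commutative monoid on the variables. *)
Definition state_space : comAlgType R[i] := malg monom R[i].

Definition mon_basis (m : monom) : state_space := mkmalgU m 1.

Definition coef (m : monom) (f : state_space) : R[i] := mcoeff m f.

Definition varphi (j : 'I_l.+1) (n : nat) : state_space :=
  mon_basis (ucm ((j, n) : var_index)).

(* d/dvarphi^j_n. The exponent subtraction in [divcm] is truncated, but the
   corresponding coefficient is then zero. *)
Definition dvarphi (j : 'I_l.+1) (n : nat) (f : state_space) : state_space :=
  \sum_(m <- msupp f)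
    ((m (j, n))%:R * coef m f) *:
      mon_basis (divcm m (ucm ((j, n) : var_index))).

(* The sums over n below are finitely supported: a polynomial involves finitely
   many variables. *)
Definition Hhat0 (hbart : R[i]) (f : state_space) : state_space :=
  hbart *: \sum_(j < l.+1) \sum_(n \in [set: nat])
    n%:R *: (varphi j n * dvarphi j n f).

Definition Hhat (hbart : R[i]) (j : 'I_l.+1) (f : state_space) : state_space :=
  hbart *: \sum_(n \in [set: nat]) varphi j n * dvarphi j n f.

(* [op_exp A f] is the polynomial to which the series of the [A^k f / k!]
   converges coefficientwise (0 if there is none). *)
Definition op_exp (A : state_space -> state_space) (f : state_space) :
    state_space :=
  xget 0 [set g : state_space | forall m : monom,
    series (fun k => coef m ((k`!%:R)^-1 *: iter k A f) : R[i]^o) @ \oo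
      --> (coef m g : R[i]^o)].

(* Diagonal matrix coefficients in the basis of monomials. *)
Definition diag_coef (A : state_space -> state_space) (m : monom) : R[i]^o :=
  coef m (A (mon_basis m)).

(* Convergence of the net of all finite partial sums, i.e., unconditional
   summability. *)
Definition has_trace (A : state_space -> state_space) : Prop :=
  cvg (partial_sum (diag_coef A) @ totally).

Definition op_trace (A : state_space -> state_space) : R[i] :=
  summability.sum (diag_coef A).

Variables (hbart beta hbar : R[i]) (lambda : 'I_l.+1 -> R[i]).

Definition boltzmann : state_space -> state_space :=
  op_exp (fun f => - (beta / hbart) *:
    (hbar *: Hhat0 hbart f + \sum_(j < l.+1) lambda j *: Hhat hbart j f)).

Definition partition_function : R[i] := op_trace boltzmann.

End StateSpace.

Definition Gamma_q (R : realType) (q t : R[i]) : R[i] :=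
  limn (fun N : nat => \prod_(0 <= k < N) (1 - t * q ^+ k)^-1 : R[i]^o).

(* Main.v *)
Require Import Defs.
From HB Require Import structures.
From mathcomp Require Import all_boot all_order all_algebra finmap.
From mathcomp Require Import all_classical all_reals all_analysis.
From mathcomp Require Import complex.
From mathcomp Require Import summability.
From mathcomp Require Import -(notations) monalg.
From mathcomp Require Import ring lra.

(** The Hamiltonian is diagonal on monomials: [varphi^j_n d/dvarphi^j_n]
    multiplies a monomial [m] by its exponent [m (j, n)], so [m] has energy
    [e(m) = - sum_(j, n) m (j, n) * beta * (lambda_j + n * hbar)].  Hence the
    exponential of the operator multiplies [m] by
    [expC e(m) = prod_(j, n) (t_j q^n)^(m (j, n))] ([diag_coef_boltzmann]),
    which rests on the exponential series converging to [expC]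
    ([cvg_exp_sum]) and on [expC] turning sums into products.

    The trace is thus the sum over all monomials of the value that they take
    when the variable [varphi^j_n] is replaced by [x_(j, n) = t_j q^n].
    Summing over the exponents of finitely many variables first gives a finite
    product of geometric series,
    [sum_m x^m = prod_(j, n) sum_k (t_j q^n)^k = prod_(j, n) (1 - t_j q^n)^-1],
    and letting the set of variables grow gives the product of the
    [Gamma_q q (t_j)].

    What has to be justified is that all finite partial sums, and not just
    those over boxes of exponents, converge ([cvg_sum_monomial_value]).  The
    same identity for the moduli [|t_j q^n|] bounds all sums of moduli by a
    convergent product, so that what a finite set of monomials containing a
    large box adds to the box is small.  The same domination, applied to
    increments of partial products, shows that the complex infinite products
    converge because those of the moduli do ([cvg_Gamma_q]). *)

Set Implicit Arguments.
Unset Strict Implicit.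
Unset Printing Implicit Defensive.

Import Order.TTheory GRing.Theory Num.Theory.
Import numFieldNormedType.Exports.
Import ComplexField.Normc.

Local Open Scope ring_scope.
Local Open Scope complex_scope.

(** * Convergence of complex numbers through the real modulus *)

Section ComplexLimits.
Variable R : realType.
Implicit Types z : R[i].

Lemma normc_real (x : R) : normc x%:C = `|x|.
Proof. by rewrite /normc /= expr0n /= addr0 sqrtr_sqr. Qed.

Lemma normc_ge0 z : 0 <= normc z.
Proof. by case: z => a b; exact: sqrtr_ge0. Qed.

Lemma normc_ltC z (e : R) : (`|z| < e%:C) = (normc z < e).
Proof. by rewrite -ltcR. Qed.

Lemma normcX z k : normc (z ^+ k) = normc z ^+ k.
Proof. by elim: k => [|k IH]; rewrite ?expr0 ?normc1 // !exprS normcM IH. Qed.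

Lemma normc_nat k : normc (k%:R : R[i]) = k%:R.
Proof. by rewrite -(rmorph_nat (real_complex R)) normc_real normr_nat. Qed.

Lemma normc_prod (I : Type) (r : seq I) (P : pred I) (F : I -> R[i]) :
  normc (\prod_(i <- r | P i) F i) = \prod_(i <- r | P i) normc (F i).
Proof. by apply: big_morph => [x y|]; rewrite ?normcM ?normc1. Qed.

Lemma le_normc_sum (I : Type) (r : seq I) (P : pred I) (F : I -> R[i]) :
  normc (\sum_(i <- r | P i) F i) <= \sum_(i <- r | P i) normc (F i).
Proof.
elim/big_ind2 : _ => [|x1 x2 y1 y2 h1 h2|//]; first by rewrite normc0.
by apply: le_trans (le_normcD _ _) _; exact: lerD.
Qed.

Lemma le_normc_ReIm z : normc z <= `|complex.Re z| + `|complex.Im z|.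
Proof.
case: z => a b /=; rewrite -[leRHS]ger0_norm ?addr_ge0 // -sqrtr_sqr.
rewrite ler_wsqrtr // sqrrD !real_normK ?num_real //.
by rewrite lerD2r lerDl mulrn_wge0 // mulr_ge0.
Qed.

(** Moduli [`|z|] are themselves complex numbers here; passing to the real
    number [normc z] makes real squeezing and linear arithmetic available. *)
Lemma cvgC_of_normc (T : Type) (F : set_system T) {FF : Filter F}
    (f : T -> R[i]^o) (a : R[i]^o) :
  ((fun x => normc (a - f x)) @ F --> (0 : R))%classic -> (f @ F --> a)%classic.
Proof.
move=> h; apply/cvgrPdist_lt => e e0.
have eE : e = (complex.Re e)%:C by rewrite RRe_real // gtr0_real.
have re0 : 0 < complex.Re e by rewrite -ltcR -eE.
move/cvgr0Pnorm_lt : h => /(_ _ re0); apply: filterS => x.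
by rewrite eE normc_ltC ger0_norm ?normc_ge0.
Qed.

Lemma cvgC_of_ReIm (T : Type) (F : set_system T) {FF : Filter F}
    (f : T -> R[i]^o) (a b : R) :
  ((fun x => complex.Re (f x)) @ F --> a)%classic ->
  ((fun x => complex.Im (f x)) @ F --> b)%classic ->
  (f @ F --> (a +i* b : R[i]^o))%classic.
Proof.
move=> ha hb; apply: cvgC_of_normc.
apply: (@squeeze_cvgr _ _ _ _ (cst 0) (fun x => `|a - complex.Re (f x)| +
   `|b - complex.Im (f x)|)).
- near=> x; rewrite normc_ge0 /=.
  by apply: le_trans (le_normc_ReIm _) _; case: (f x).
- exact: cvg_cst.
- rewrite -[0]addr0; apply: cvgD.
    rewrite -(@normr0 _ R) -(subrr a); apply: cvg_norm.
    by apply: cvgB => //; exact: cvg_cst.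
  rewrite -(@normr0 _ R) -(subrr b); apply: cvg_norm.
  by apply: cvgB => //; exact: cvg_cst.
Unshelve. all: by end_near. Qed.

Lemma ler_Re_normc z : `|complex.Re z| <= normc z.
Proof. by rewrite -lecR; exact: normc_ge_Re. Qed.

Lemma ler_Im_normc z : `|complex.Im z| <= normc z.
Proof.
case: z => a b /=; rewrite -sqrtr_sqr ler_wsqrtr // lerDr; exact: sqr_ge0.
Qed.

(** Domination makes both [v] and [u + v] nondecreasing and bounded, and [u] is
    their difference. *)
Lemma cvg_dominated_increments_real (u v : R^nat) (M : R) :
  (forall m n, (m <= n)%N -> `|u n - u m| <= v n - v m) ->
  (forall n, v n <= M) -> cvgn u.
Proof.
move=> uv vM.
have vcvg : cvgn v.
  apply: nondecreasing_is_cvgn; last by exists M => _ [n _ <-].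
  by move=> m n mn; rewrite -subr_ge0; apply: le_trans (uv _ _ mn).
have uvcvg : cvgn (u + v).
  apply: nondecreasing_is_cvgn.
    move=> m n mn; have := uv _ _ mn; rewrite ler_norml => /andP[+ _].
    by rewrite !fctE; lra.
  exists (`|u 0%N| - v 0%N + M + M) => _ [n _ <-]; rewrite !fctE.
  have := uv _ _ (leq0n n); rewrite ler_norml => /andP[_].
  by have := vM n; have := ler_norm (u 0%N); lra.
have -> : u = (u + v) - v by apply/funext => n; rewrite !fctE addrK.
exact: is_cvgB.
Qed.

(** Real and imaginary parts have increments no larger than those of [u], so
    the real case applies to each of them. *)
Lemma cvgC_dominated_increments (u : nat -> R[i]^o) (v : R^nat) (M : R) :
  (forall m n, (m <= n)%N -> normc (u n - u m) <= v n - v m) ->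
  (forall n, v n <= M) -> cvgn u.
Proof.
move=> uv vM.
have hre : cvgn (fun n => complex.Re (u n)).
  apply: (cvg_dominated_increments_real _ vM) => m n mn.
  apply: le_trans (uv _ _ mn); apply: le_trans (ler_Re_normc _).
  by case: (u n); case: (u m).
have him : cvgn (fun n => complex.Im (u n)).
  apply: (cvg_dominated_increments_real _ vM) => m n mn.
  apply: le_trans (uv _ _ mn); apply: le_trans (ler_Im_normc _).
  by case: (u n); case: (u m).
by apply/cvg_ex; eexists; exact: cvgC_of_ReIm hre him.
Qed.

End ComplexLimits.

(** * The complex exponential series *)

Section ComplexExponential.
Variable R : realType.

Definition exp_sum (K : numFieldType) (z : K) (n : nat) : K :=
  \sum_(0 <= k < n) z ^+ k / k`!%:R.

(** In the square of indices [i, j < n], the truncated series of [a + b] is, by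
    the binomial formula, the part with [i + j < n]; the coefficients of what
    remains are nonnegative, so that taking moduli termwise yields the same
    difference for [|a|] and [|b|]. *)
Lemma exp_sumM_sub (K : numFieldType) (a b : K) n :
  exp_sum a n * exp_sum b n - exp_sum (a + b) n =
  \sum_(0 <= i < n) \sum_(n - i <= j < n) (a ^+ i / i`!%:R) * (b ^+ j / j`!%:R).
Proof.
pose F i j := (a ^+ i / i`!%:R) * (b ^+ j / j`!%:R).
have -> : exp_sum (a + b) n = \sum_(0 <= i < n) \sum_(0 <= j < n - i) F i j.
  transitivity (\sum_(0 <= k < n) \sum_(0 <= i < n | (i <= k)%N) F i (k - i)%N).
    rewrite /exp_sum big_nat [RHS]big_nat; apply: eq_bigr => k /andP[_ kn].
    transitivity (\sum_(i < k.+1) F i (k - i)%N); last first.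
      rewrite big_mkord (big_ord_widen_cond n xpredT (fun i => F i (k - i)%N)) //.
    rewrite addrC exprDn big_distrl /=; apply: eq_bigr => i _.
    have ik : (i <= k)%N by rewrite -ltnS.
    rewrite /F -mulr_natr -(bin_fact ik) !natrM; field.
    by rewrite !pnatr_eq0 -!lt0n !fact_gt0 bin_gt0 ik.
  rewrite (exchange_big_dep_nat xpredT) //=; apply: eq_big_nat => i /andP[_ ilt].
  rewrite -(big_nat_widenl i 0 n xpredT (fun k => F i (k - i)%N)) //.
  rewrite -{1}(add0n i) big_addn.
  by apply: eq_bigr => j _; rewrite addnK.
rewrite /exp_sum big_distrl /= -sumrB; apply: eq_big_nat => i /andP[_ ilt].
rewrite big_distrr /= (@big_cat_nat _ _ _ (n - i)) ?leq_subr //=.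
by rewrite addrAC subrr add0r.
Qed.

Lemma cvg_exp_sum_real (x : R) : (exp_sum x @ \oo --> expR x)%classic.
Proof. exact: is_cvg_series_exp_coeff. Qed.

(** This reduces the addition formula for the complex series to the real one:
    the right-hand side tends to [expR |a| expR |b| - expR (|a| + |b|) = 0]. *)
Lemma normc_exp_sumM_sub (a b : R[i]) n :
  normc (exp_sum a n * exp_sum b n - exp_sum (a + b) n) <=
  exp_sum (normc a) n * exp_sum (normc b) n - exp_sum (normc a + normc b) n.
Proof.
rewrite !exp_sumM_sub; apply: le_trans (le_normc_sum _ _ _) _.
apply: ler_sum => i _; apply: le_trans (le_normc_sum _ _ _) _.
apply: ler_sum => j _.
by rewrite !(normcM, normcV, normcX, normc_nat).
Qed.

Lemma exp_sum_real_complex (x : R) n : exp_sum (x%:C) n = (exp_sum x n)%:C.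
Proof.
rewrite /exp_sum rmorph_sum; apply: eq_bigr => k _.
by rewrite fmorph_div rmorphXn rmorph_nat.
Qed.

Lemma exp_term_imaginary (y : R) k :
  ((0 : R) +i* y) ^+ k / k`!%:R = cos_coeff y k +i* sin_coeff y k.
Proof.
have iyE : ((0 : R) +i* y) = 'i * y%:C by rewrite [LHS]complexE /= add0r.
have sqi h : ('i : R[i]) ^+ h.*2 = ((-1) ^+ h)%:C.
  by rewrite -mul2n exprM sqr_i rmorphXn rmorphN1.
rewrite iyE exprMn -rmorphXn -(rmorph_nat (real_complex R)) -mulrA -fmorph_div.
rewrite /cos_coeff /sin_coeff /= -[in 'i ^+ k](odd_double_half k) exprD sqi.
case: (boolP (odd k)) => ok /=.
  have -> : k.-1./2 = k./2.
    by rewrite -{1}(odd_double_half k) ok /= doubleK.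
  rewrite expr1; apply/eqP; rewrite eq_complex /= -exprnP -!mulrA.
  move: ((-1) ^+ _) (y ^+ k / _) => s c.
  by apply/andP; split; apply/eqP; ring.
rewrite expr0 mul1r -rmorphM -exprnP !mul0r mul1r mulrA.
by [].
Qed.

Lemma cvg_exp_sum_imaginary (y : R) :
  ((exp_sum ((0 : R) +i* y) : nat -> R[i]^o) @ \oo
     --> (cos y +i* sin y : R[i]^o))%classic.
Proof.
have sE n : exp_sum ((0 : R) +i* y) n =
    series (cos_coeff y) n +i* series (sin_coeff y) n.
  rewrite /exp_sum /series /=; under eq_bigr do rewrite exp_term_imaginary.
  by elim/big_rec3 : _ => // k u v w _ ->.
apply: cvgC_of_ReIm.
  under eq_fun do rewrite sE /=.
  by rewrite unlock; exact: is_cvg_series_cos_coeff.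
under eq_fun do rewrite sE /=.
by rewrite unlock; exact: is_cvg_series_sin_coeff.
Qed.

Lemma cvgC_real_complex (f : nat -> R) (a : R) :
  (f @ \oo --> a)%classic ->
  ((fun n => (f n)%:C : R[i]^o) @ \oo --> (a%:C : R[i]^o))%classic.
Proof. by move=> fa; apply: cvgC_of_ReIm; [exact: fa|exact: cvg_cst]. Qed.

(** The real and the imaginary axis are known from the series of [expR], [cos]
    and [sin]; the general case follows by splitting [z] into its two parts,
    up to the error controlled by [normc_exp_sumM_sub]. *)
Theorem cvg_exp_sum (z : R[i]) :
  ((exp_sum z : nat -> R[i]^o) @ \oo --> (expC z : R[i]^o))%classic.
Proof.
pose a : R[i] := (complex.Re z)%:C; pose b : R[i] := 0 +i* complex.Im z.
have zE : z = a + b by apply/eqP; rewrite eq_complex /= addr0 add0r !eqxx.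
pose d n : R[i]^o := exp_sum a n * exp_sum b n - exp_sum z n.
have d0 : (d @ \oo --> (0 : R[i]^o))%classic.
  apply: cvgC_of_normc; under eq_fun do rewrite sub0r normcN.
  apply: (@squeeze_cvgr _ _ _ _ (cst 0) (fun n =>
     exp_sum (normc a) n * exp_sum (normc b) n -
     exp_sum (normc a + normc b) n)).
  - by near=> n; rewrite normc_ge0 /d zE normc_exp_sumM_sub.
  - exact: cvg_cst.
  - rewrite -(subrr (expR (normc a + normc b))) {1}expRD.
    by apply: cvgB; [apply: cvgM|]; exact: cvg_exp_sum_real.
have -> : exp_sum z = (fun n => exp_sum a n * exp_sum b n - d n) :> (nat -> R[i]^o).
  by apply/funext => n; rewrite /d opprB addrCA subrr addr0.
rewrite -[X in (_ --> X)%classic]subr0; apply: cvgB d0.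
rewrite /expC; apply: (@cvgM _ _ _ _ (exp_sum a : nat -> R[i]^o) (exp_sum b)).
  2: exact: cvg_exp_sum_imaginary.
rewrite (_ : exp_sum a = fun n => (exp_sum (complex.Re z) n)%:C); last first.
  by apply/funext => n; rewrite exp_sum_real_complex.
exact/cvgC_real_complex/cvg_exp_sum_real.
Unshelve. all: by end_near. Qed.

Lemma expC0 : expC (0 : R[i]) = 1.
Proof. by rewrite /expC /= expR0 cos0 sin0 mul1r. Qed.

Lemma expCD (z w : R[i]) : expC (z + w) = expC z * expC w.
Proof.
case: z => a b; case: w => c d; rewrite /expC /= expRD cosD sinD.
by apply/eqP; rewrite eq_complex /=; apply/andP; split; apply/eqP; ring.
Qed.

Lemma expC_sum (I : Type) (r : seq I) (P : pred I) (F : I -> R[i]) :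
  expC (\sum_(i <- r | P i) F i) = \prod_(i <- r | P i) expC (F i).
Proof. by apply: big_morph; [exact: expCD|exact: expC0]. Qed.

Lemma expC_natmul (z : R[i]) n : expC (n%:R * z) = expC z ^+ n.
Proof.
elim: n => [|n IH]; first by rewrite mul0r expC0.
by rewrite -addn1 natrD mulrDl mul1r expCD IH addn1 exprSr.
Qed.

End ComplexExponential.

(** * Summing monomials over a box of exponents *)

Section MonomialBoxes.
Variable I : choiceType.
Implicit Types (m : cmonom I) (D : {fset I}).

Definition monomial_value (K : comNzRingType) (x : I -> K) m : K :=
  \prod_(i <- finsupp m) x i ^+ m i.

Lemma monomial_valueE (K : comNzRingType) (x : I -> K) m D :
  (finsupp m `<=` D)%fset -> monomial_value x m = \prod_(i <- D) x i ^+ m i.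
Proof.
move=> mD; apply: big_fset_incl => // i _.
by rewrite memNfinsupp => /eqP ->; rewrite expr0.
Qed.

Definition monomial_of_exponents D K (f : {ffun D -> 'I_K}) : cmonom I :=
  CMonom [fsfun i : D => nat_of_ord (f i) | 0%N].

Lemma monomial_of_exponentsE D K (f : {ffun D -> 'I_K}) (i : D) :
  monomial_of_exponents f (val i) = f i.
Proof. by rewrite /= fsfun_ffun valK. Qed.

Lemma finsupp_monomial_of_exponents D K (f : {ffun D -> 'I_K}) :
  (finsupp (monomial_of_exponents f) `<=` D)%fset.
Proof.
apply/fsubsetP => i; rewrite mem_finsupp /= fsfun_ffun.
by case: insubP => //=; rewrite eqxx.
Qed.

Lemma monomial_of_exponents_inj D K :
  injective (@monomial_of_exponents D K).
Proof.
move=> f g fg; apply/ffunP => i; apply/val_inj.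
by rewrite /= -!monomial_of_exponentsE fg.
Qed.

Definition monomial_box D K : {fset cmonom I} :=
  [fset monomial_of_exponents f | f : {ffun D -> 'I_K}]%fset.

Lemma in_monomial_box m D K :
  (finsupp m `<=` D)%fset -> (forall i, m i < K)%N -> m \in monomial_box D K.
Proof.
move=> mD mK; apply/imfsetP; exists [ffun i : D => Ordinal (mK (val i))] => //.
apply/eqP/cmP => i; case: (boolP (i \in D)) => [iD|niD].
  by rewrite (monomial_of_exponentsE _ [`iD]%fset) ffunE.
have -> : m i = 0%N.
  by apply/eqP; rewrite cmE_eq0; apply: contra niD; exact: (fsubsetP mD).
by apply/esym/eqP; rewrite cmE_eq0; apply: contra niD;
  exact/fsubsetP/finsupp_monomial_of_exponents.
Qed.

Lemma monomial_box_exhaust (D : nat -> {fset I}) (A : {fset cmonom I}) :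
  {homo D : m n / (m <= n)%N >-> (m `<=` n)%fset} ->
  (forall B, exists N, (B `<=` D N)%fset) ->
  exists N K, (A `<=` monomial_box (D N) K)%fset.
Proof.
move=> Dmono Dex.
have [N hN] := Dex (\bigcup_(m <- A) finsupp m)%fset.
exists N, (\max_(m <- A) \max_(i <- finsupp m) m i).+1.
apply/fsubsetP => m mA.
have mN : (finsupp m `<=` D N)%fset by apply: fsubset_trans hN; exact: bigfcup_sup.
apply: in_monomial_box => // i; rewrite ltnS.
have [im|im] := boolP (i \in finsupp m); last first.
  by move: im; rewrite -cmE_eq0 => /eqP ->.
by apply: (leq_trans _ (leq_bigmax_seq _ mA _)) => //; exact: leq_bigmax_seq.
Qed.

(** Distributivity: expanding the product of the geometric sums chooses one
    exponent below [n] for each variable in [D]. *)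
Lemma sum_monomial_box (K : comNzRingType) (x : I -> K) D n :
  \sum_(m <- monomial_box D n) monomial_value x m =
  \prod_(i <- D) \sum_(k < n) x i ^+ k.
Proof.
rewrite big_imfset /=; last by move=> f g _ _; exact: monomial_of_exponents_inj.
rewrite [RHS]big_seq_fsetE /= bigA_distr_bigA /=.
rewrite [LHS]big_enum /=.
apply: eq_bigr => f _.
rewrite (monomial_valueE _ (finsupp_monomial_of_exponents f)) big_seq_fsetE /=.
by apply: eq_bigr => i _; rewrite monomial_of_exponentsE.
Qed.

End MonomialBoxes.

Lemma cvg_prod_seq (K : numFieldType) (I : Type) (r : seq I)
    (f : I -> nat -> K) (l : I -> K) :
  (forall i, f i @ \oo --> l i)%classic ->
  ((fun n => \prod_(i <- r) f i n) @ \oo --> \prod_(i <- r) l i)%classic.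
Proof.
move=> fl; elim: r => [|i r IH].
  by rewrite big_nil; under eq_fun do rewrite big_nil; exact: cvg_cst.
by rewrite big_cons; under eq_fun do rewrite big_cons; exact: cvgM.
Qed.

Lemma cvg_geometric_sum (K : numFieldType) (x : K) : x != 1 ->
  (GRing.exp x @ \oo --> (0 : K))%classic ->
  ((fun n => \sum_(k < n) x ^+ k) @ \oo --> (1 - x)^-1)%classic.
Proof.
move=> x1 x0.
have -> : (fun n => \sum_(k < n) x ^+ k) =
    (fun n => (1 - x ^+ n) * (1 - x)^-1).
  apply/funext => n; rewrite -opprB subrX1 -mulNr opprB mulrAC divff ?mul1r //.
  by rewrite subr_eq0 eq_sym.
rewrite -[X in (_ --> X)%classic]mul1r; apply: cvgM; last exact: cvg_cst.
rewrite -[X in (_ --> X)%classic]subr0.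
by apply: (@cvgB _ K^o _ _ _ (cst 1) (GRing.exp x)) => //; exact: cvg_cst.
Qed.

(** * Unconditional convergence of the sum over all monomials *)

Section MonomialSums.
Variables (R : realType) (I : choiceType) (x : I -> R[i]) (D : nat -> {fset I}).
Hypothesis x_lt1 : forall i, normc (x i) < 1.
Hypothesis D_mono : {homo D : m n / (m <= n)%N >-> (m `<=` n)%fset}.
Hypothesis D_exhaust : forall A, exists N, (A `<=` D N)%fset.

Let ax i := normc (x i).
Let P N := \prod_(i <- D N) (1 - x i)^-1.
Let Q N := \prod_(i <- D N) (1 - ax i)^-1.

Lemma normc_monomial_value m : normc (monomial_value x m) = monomial_value ax m.
Proof. by rewrite normc_prod; apply: eq_bigr => i _; rewrite normcX. Qed.

Lemma monomial_value_normc_ge0 m : 0 <= monomial_value ax m.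
Proof. by apply: prodr_ge0 => i _; rewrite exprn_ge0 ?normc_ge0. Qed.

Lemma cvg_sum_monomial_box N :
  ((fun n => \sum_(m <- monomial_box (D N) n) monomial_value x m : R[i]^o)
     @ \oo --> (P N : R[i]^o))%classic.
Proof.
under eq_fun do rewrite sum_monomial_box.
apply: (@cvg_prod_seq R[i] I (D N) (fun i n => \sum_(k < n) x i ^+ k)
  (fun i => (1 - x i)^-1)) => i; apply: cvg_geometric_sum.
  by apply: contraTneq (x_lt1 i) => ->; rewrite normc1 ltxx.
apply: (@cvgC_of_normc R nat \oo%classic _ (GRing.exp (x i)) 0).
under eq_fun do rewrite sub0r normcN normcX.
by apply: cvg_expr; rewrite ger0_norm ?normc_ge0 ?x_lt1.
Qed.

Lemma cvg_sum_monomial_box_normc N :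
  ((fun n => \sum_(m <- monomial_box (D N) n) monomial_value ax m)
     @ \oo --> Q N)%classic.
Proof.
under eq_fun do rewrite sum_monomial_box.
apply: cvg_prod_seq => i; apply: cvg_geometric_sum.
  by rewrite lt_eqF // x_lt1.
by apply: cvg_expr; rewrite ger0_norm ?normc_ge0 ?x_lt1.
Qed.

Lemma one_sub_normc_inv_ge1 i : 1 <= (1 - ax i)^-1.
Proof.
rewrite invf_ge1 ?subr_gt0 //; last exact: x_lt1.
by rewrite lerBlDr lerDl normc_ge0.
Qed.

Lemma nondecreasing_Q : {homo Q : m n / (m <= n)%N >-> m <= n}.
Proof.
move=> M N MN; have DMN := D_mono MN.
pose F i := if i \in D M then (1 - ax i)^-1 else 1.
have -> : Q M = \prod_(i <- D N) F i.
  transitivity (\prod_(i <- D M) F i).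
    by apply: eq_big_seq => i iM; rewrite /F iM.
  by apply: big_fset_incl => // i _ iM; rewrite /F (negbTE iM).
apply: ler_prod => i _; have i1 := one_sub_normc_inv_ge1 i.
by rewrite /F; case: ifP => _; rewrite ?lexx ?ler01 ?i1 ?(le_trans ler01 i1).
Qed.

(** Any finite set of monomials lies in a box, over which the sum of moduli is a
    product of truncated geometric series. *)
Lemma sum_normc_le (A : {fset cmonom I}) :
  exists N, \sum_(m <- A) monomial_value ax m <= Q N.
Proof.
have [N [K AK]] := monomial_box_exhaust A D_mono D_exhaust.
exists N.
apply: (@le_trans _ _
  (\sum_(m <- monomial_box (D N) K) monomial_value ax m)).
  pose F m := if m \in A then monomial_value ax m else 0.
  have -> : \sum_(m <- A) monomial_value ax m =
      \sum_(m <- monomial_box (D N) K) F m.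
    transitivity (\sum_(m <- A) F m).
      by apply: eq_big_seq => m mA; rewrite /F mA.
    by apply: big_fset_incl => // m _ mA; rewrite /F (negbTE mA).
  apply: ler_sum => m _; rewrite /F; case: ifP => // _.
  exact: monomial_value_normc_ge0.
rewrite sum_monomial_box; apply: ler_prod => i _.
apply/andP; split; first by apply: sumr_ge0 => k _; rewrite exprn_ge0 ?normc_ge0.
have x1 : 0 < 1 - ax i by rewrite subr_gt0 x_lt1.
rewrite -[leRHS]mul1r ler_pdivlMr // mulrC -[X in X * _]opprB mulNr -subrX1 opprB.
by rewrite gerBl exprn_ge0 ?normc_ge0.
Qed.

(** Absolute summability enters here: as the sums of moduli are bounded, the
    right-hand side is small once [B] carries almost all of them. *)
Lemma sum_box_dist (A B : {fset cmonom I}) : (B `<=` A)%fset ->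
  normc (\sum_(m <- A) monomial_value x m - \sum_(m <- B) monomial_value x m) <=
  \sum_(m <- A) monomial_value ax m - \sum_(m <- B) monomial_value ax m.
Proof.
move=> BA.
have extend (V : zmodType) (w : cmonom I -> V) : \sum_(m <- B) w m =
    \sum_(m <- A) if m \in B then w m else 0.
  transitivity (\sum_(m <- B) if m \in B then w m else 0).
    by apply: eq_big_seq => m ->.
  by apply: big_fset_incl => // m _ /negbTE ->.
rewrite !extend -!sumrB; apply: le_trans (le_normc_sum _ _ _) _.
apply: ler_sum => m _; case: ifP => _; first by rewrite !subrr normc0.
by rewrite !subr0 normc_monomial_value.
Qed.

(** The distance to [l] of a sum over [A] containing the box splits into three
    parts: [l] to [P N], [P N] to the box, and the box to [A].  The last one is
    bounded by the distance from the box sum of moduli to the limit of [Q],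
    which splits in turn at [Q N]. *)
Theorem cvg_sum_monomial_value (l : R[i]^o) (M : R) :
  ((P : nat -> R[i]^o) @ \oo --> l)%classic -> (forall N, Q N <= M) ->
  (partial_sum (monomial_value x : _ -> R[i]^o) @ totally --> l)%classic.
Proof.
move=> Pl QM.
have Qcvg : cvgn Q.
  by apply: nondecreasing_is_cvgn; [exact: nondecreasing_Q|exists M => _ [n _ <-]].
have Qle N : Q N <= limn Q.
  by apply: nondecreasing_cvgn_le Qcvg _; exact: nondecreasing_Q.
have FF := @totally_filter (cmonom I).
apply: cvgC_of_normc; apply/cvgr0Pnorm_lt => e e0.
(* Four distances are to be made small: from [P N] to its limit and to its box
   sum, and the same two for [Q N]. *)
have e4 : 0 < e / 4 by rewrite divr_gt0.
have e4C : 0 < (e / 4)%:C by rewrite ltcR.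
have [N [PN QN]] : exists N, normc (l - P N) < e / 4 /\ `|limn Q - Q N| < e / 4.
  move/cvgrPdist_lt : Pl => /(_ _ e4C) h1.
  move/cvgrPdist_lt : Qcvg => /(_ _ e4) h2.
  have [N _ hN] : (\forall N \near \oo,
      normc (l - P N) < e / 4 /\ `|limn Q - Q N| < e / 4)%classic.
    by apply: filterS2 h1 h2 => N; rewrite normc_ltC.
  by exists N; apply: hN => /=.
have [K [PK QK]] : exists K,
    normc (P N - \sum_(m <- monomial_box (D N) K) monomial_value x m) < e / 4 /\
    `|Q N - \sum_(m <- monomial_box (D N) K) monomial_value ax m| < e / 4.
  have /cvgrPdist_lt /(_ _ e4C) h1 := @cvg_sum_monomial_box N.
  have /cvgrPdist_lt /(_ _ e4) h2 := @cvg_sum_monomial_box_normc N.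
  have [K _ hK] : (\forall K \near \oo,
    normc (P N - \sum_(m <- monomial_box (D N) K) monomial_value x m) < e / 4 /\
    `|Q N - \sum_(m <- monomial_box (D N) K) monomial_value ax m| < e / 4)%classic.
    by apply: filterS2 h1 h2 => K; rewrite normc_ltC.
  by exists K; apply: hK => /=.
exists (monomial_box (D N) K) => // A /= BA.
rewrite ger0_norm ?normc_ge0 // /partial_sum -(big_seq_fsetE _ A xpredT) /=.
have [N' AN'] := sum_normc_le A.
have AB := sum_box_dist BA.
move: QN QK; rewrite !ltr_norml => /andP[QN1 QN2] /andP[QK1 QK2].
set SA := \sum_(m <- A) _ in AB *.
set SB := \sum_(m <- monomial_box _ _) _ in PK AB *.
have -> : l - SA = (l - P N) + (P N - SB) - (SA - SB) by ring.
have := le_normcD (l - P N + (P N - SB)) (- (SA - SB)).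
have := le_normcD (l - P N) (P N - SB).
rewrite normcN; move: (Qle N').
move: PN PK AB AN' QN1 QN2 QK1 QK2.
rewrite -/SA -/SB.
set v1 := normc _; set v2 := normc _; set v3 := normc _; set v4 := normc (_ + _).
set v5 := normc _; lra.
Qed.

End MonomialSums.

(** * The q-Gamma product converges *)

Section QGamma.
Variable R : realType.

(** In [a p - 1 = a (p - 1) + (a - 1)], each factor on the right is dominated,
    and [b s - 1] decomposes in the same way. *)
Lemma prod_sub1_dominated (I : Type) (r : seq I) (a : I -> R[i]) (b : I -> R) :
  (forall i, normc (a i - 1) <= b i - 1) ->
  normc (\prod_(i <- r) a i - 1) <= \prod_(i <- r) b i - 1.
Proof.
move=> ab; elim: r => [|i r IH]; first by rewrite !big_nil !subrr normc0.
rewrite !big_cons; set p := \prod_(j <- r) a j in IH *.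
set s := \prod_(j <- r) b j in IH *.
have -> : a i * p - 1 = a i * (p - 1) + (a i - 1) by ring.
have ai : normc (a i) <= b i.
  have := le_normcD (a i - 1) 1; rewrite subrK normc1.
  by have := ab i; lra.
have h1 := le_normcD (a i * (p - 1)) (a i - 1).
have h2 : normc (a i * (p - 1)) <= b i * (s - 1).
  by rewrite normcM; apply: ler_pM => //; exact: normc_ge0.
by move: (ab i); lra.
Qed.

Lemma inv_one_sub_dominated (x : R[i]) : normc x < 1 ->
  normc ((1 - x)^-1 - 1) <= (1 - normc x)^-1 - 1.
Proof.
move=> x1; have x0 : 1 - x != 0.
  rewrite subr_eq0; apply: contraTneq x1 => <-; by rewrite normc1 ltxx.
have nx0 : 0 < 1 - normc x by rewrite subr_gt0.
have -> : (1 - x)^-1 - 1 = x * (1 - x)^-1 by field.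
have -> : (1 - normc x)^-1 - 1 = normc x * (1 - normc x)^-1.
  by field; rewrite gt_eqF.
rewrite normcM normcV ler_wpM2l ?normc_ge0 //.
have le1x : 1 - normc x <= normc (1 - x).
  by have := le_normcD (1 - x) x; rewrite subrK normc1; lra.
by rewrite lef_pV2 // posrE; exact: lt_le_trans le1x.
Qed.

Lemma normc_geometric_lt1 (t q : R[i]) k :
  normc q < 1 -> normc t < 1 -> normc (t * q ^+ k) < 1.
Proof.
move=> q1 t1; rewrite normcM normcX; apply: le_lt_trans t1.
by rewrite ler_piMr ?normc_ge0 // exprn_ile1 ?normc_ge0 // ltW.
Qed.

(** From [(1 - u)^-1 = 1 + u / (1 - u) <= exp (u / (1 - r))] for
    [u = r s^k <= r], the product is at most the exponential of a geometric
    series. *)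
Lemma q_product_bounded (r s : R) (N : nat) : 0 <= r < 1 -> 0 <= s < 1 ->
  \prod_(0 <= k < N) (1 - r * s ^+ k)^-1 <= expR (r / (1 - r) * (1 - s)^-1).
Proof.
move=> /andP[r0 r1] /andP[s0 s1].
apply: (@le_trans _ _ (\prod_(0 <= k < N) expR (r / (1 - r) * s ^+ k))).
  apply: ler_prod => k _.
  have sk0 : 0 <= s ^+ k by exact: exprn_ge0.
  have rsk : r * s ^+ k <= r by rewrite ler_piMr // exprn_ile1 // ltW.
  have d0 : 0 < 1 - r * s ^+ k by lra.
  have d1 : 0 < 1 - r by lra.
  rewrite invr_ge0 ltW //=; apply: le_trans (expR_ge1Dx _).
  have -> : (1 - r * s ^+ k)^-1 = 1 + r * s ^+ k * (1 - r * s ^+ k)^-1.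
    by field; rewrite gt_eqF.
  by rewrite lerD2l mulrAC ler_wpM2r // ler_wpM2l // lef_pV2 ?posrE // lerB.
rewrite -expR_sum ler_expR -mulr_sumr ler_wpM2l ?divr_ge0 ?subr_ge0 ?(ltW r1) //.
have d1 : 0 < 1 - s by rewrite subr_gt0.
rewrite -[leRHS]mul1r ler_pdivlMr // big_mkord mulrC -[X in X * _]opprB mulNr.
by rewrite -subrX1 opprB gerBl exprn_ge0.
Qed.

Lemma normc_q_product_bounded (q t : R[i]) (N : nat) :
  normc q < 1 -> normc t < 1 ->
  \prod_(0 <= k < N) (1 - normc (t * q ^+ k))^-1 <=
  expR (normc t / (1 - normc t) * (1 - normc q)^-1).
Proof.
move=> q1 t1; under eq_bigr do rewrite normcM normcX.
by apply: q_product_bounded; rewrite ?normc_ge0.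
Qed.

(** The increment [P_n - P_m = P_m * (prod_(m <= k < n) - 1)] is dominated
    factor by factor by that of the product of moduli, which is bounded. *)
Theorem cvg_Gamma_q (q t : R[i]) : normc q < 1 -> normc t < 1 ->
  ((fun N => \prod_(0 <= k < N) (1 - t * q ^+ k)^-1 : R[i]^o) @ \oo
     --> (Gamma_q q t : R[i]^o))%classic.
Proof.
move=> q1 t1; pose x k := t * q ^+ k.
have x1 k : normc (x k) < 1 by exact: normc_geometric_lt1.
pose v N := \prod_(0 <= k < N) (1 - normc (x k))^-1.
suff : cvgn (fun N => \prod_(0 <= k < N) (1 - x k)^-1 : R[i]^o) by [].
apply: (@cvgC_dominated_increments _ _ v
  (expR (normc t / (1 - normc t) * (1 - normc q)^-1))); last first.
  by move=> N; exact: normc_q_product_bounded.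
move=> m n mn; rewrite /v !(@big_cat_nat _ _ _ m 0 n) //=.
set pm := \prod_(0 <= k < m) (1 - x k)^-1; set vm := \prod_(0 <= k < m) _.
set p := \prod_(m <= k < n) (1 - x k)^-1; set w := \prod_(m <= k < n) _.
have -> : pm * p - pm = pm * (p - 1) by ring.
have -> : vm * w - vm = vm * (w - 1) by ring.
rewrite normcM; apply: ler_pM; rewrite ?normc_ge0 //; last first.
  by apply: prod_sub1_dominated => k; exact: inv_one_sub_dominated.
have := @prod_sub1_dominated _ (index_iota 0 m) _ _
  (fun k => inv_one_sub_dominated (x1 k)).
rewrite -/pm -/vm; have := le_normcD (pm - 1) 1; rewrite subrK normc1; lra.
Qed.

End QGamma.

(** * Exhausting the variables *)

Section VariableBoxes.
Variable l : nat.

Definition var_box N : {fset var_index l} :=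
  [fset ((p.1, nat_of_ord p.2) : var_index l) | p : 'I_l.+1 * 'I_N]%fset.

Lemma in_var_box N (i : var_index l) : (i \in var_box N) = (i.2 < N)%N.
Proof.
apply/imfsetP/idP => [[p _ ->] //=|iN]; exists (i.1, Ordinal iN) => //=.
by case: (i).
Qed.

Lemma var_box_mono : {homo var_box : m n / (m <= n)%N >-> (m `<=` n)%fset}.
Proof.
by move=> m n mn; apply/fsubsetP => i; rewrite !in_var_box => /leq_trans; apply.
Qed.

Lemma var_box_exhaust (A : {fset var_index l}) : exists N, (A `<=` var_box N)%fset.
Proof.
exists (\max_(i <- A) i.2).+1; apply/fsubsetP => i iA; rewrite in_var_box ltnS.
exact: leq_bigmax_seq.
Qed.

Lemma prod_var_box (K : comNzRingType) (F : var_index l -> K) N :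
  \prod_(i <- var_box N) F i = \prod_(j < l.+1) \prod_(0 <= n < N) F (j, n).
Proof.
rewrite big_imfset /=; last first.
  by move=> [j n] [j' n'] _ _ /= [-> nn]; congr pair; exact: val_inj.
rewrite big_enum /= -(pair_bigA _ (fun j (n : 'I_N) => F (j, nat_of_ord n))) /=.
by apply: eq_bigr => j _; rewrite big_mkord.
Qed.

End VariableBoxes.

(** * Energy levels and the Boltzmann operator *)

Lemma scale_affine_combination (K : comNzRingType) (V : lmodType K) (n : nat)
    (a b c : K) (F G : 'I_n -> K) (v : V) :
  a *: (b *: (c *: \sum_j F j *: v) + \sum_j G j *: v) =
  (a * (b * (c * \sum_j F j) + \sum_j G j)) *: v.
Proof. by rewrite -!scaler_suml !scalerA -scalerDl scalerA mulrA. Qed.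

Section Spectrum.
Variables (R : realType) (l : nat).
Implicit Types (m : monom l) (c : R[i]).

Lemma mon_basisM m m' : mon_basis R m * mon_basis R m' = mon_basis R (mulcm m m').
Proof.
have := @fgmulUU (monom l) R[i] 1 1 m m'.
by rewrite (mulr1 1).
Qed.

(** When the exponent is positive the truncated subtraction in [dvarphi] is a
    true one, undone by the product with [varphi]; otherwise both sides
    vanish. *)
Lemma varphi_dvarphi j n c m :
  varphi R j n * dvarphi j n (c *: mon_basis R m) =
  ((m (j, n))%:R * c) *: mon_basis R m.
Proof.
rewrite /dvarphi msuppZ; have [->|c0] := eqVneq c 0.
  by rewrite big_seq_fset0 mulr0 mulr0 scale0r.
rewrite msuppU1 big_seq_fset1 /coef mcoeffZ mcoeffU eqxx mulr1n mulr1.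
rewrite -scalerAr.
have [->|mn0] := eqVneq (m (j, n)) 0%N; first by rewrite (mul0r c) !scale0r.
congr (_ *: _).
rewrite /varphi mon_basisM; congr mon_basis.
apply/eqP/cmP => i; rewrite mulcmE divcmE cmU.
by case: eqVneq => [<-|_]; rewrite ?subn0 // subnKC // lt0n.
Qed.

Lemma sum_varphi_dvarphi (w : nat -> R[i]) j c m N :
  (finsupp m `<=` var_box l N)%fset ->
  \sum_(n \in [set: nat]) w n *: (varphi R j n * dvarphi j n (c *: mon_basis R m))
  = (\sum_(0 <= n < N) (m (j, n))%:R * w n * c) *: mon_basis R m.
Proof.
move=> mN; under eq_fsbigr do rewrite varphi_dvarphi scalerA.
rewrite (fsbigE (iota 0 N)) ?iota_uniq // => [|n _ nN]; last first.
  have -> : m (j, n) = 0%N.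
    apply/eqP; rewrite cmE_eq0; apply: contra nN => /(fsubsetP mN).
    by rewrite in_var_box mem_iota.
  by rewrite mul0r mulr0 scale0r.
rewrite scaler_suml /index_iota subn0; apply: eq_big => n.
  by rewrite in_setT.
by move=> _; rewrite mulrA [w n * _]mulrC.
Qed.

Variables (hbart beta hbar : R[i]) (lambda : 'I_l.+1 -> R[i]).

Definition hamiltonian (f : state_space R l) : state_space R l :=
  - (beta / hbart) *:
    (hbar *: Hhat0 hbart f + \sum_(j < l.+1) lambda j *: Hhat hbart j f).

(** [N] truncates the sum over modes: the value is the same for every [N] such
    that [var_box l N] contains the variables of [m]. *)
Definition energy m N : R[i] :=
  \sum_(j < l.+1) \sum_(0 <= n < N)
     (m (j, n))%:R * (- (beta * lambda j) + n%:R * - (beta * hbar)).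

Lemma hamiltonian_mon c m N : hbart != 0 -> (finsupp m `<=` var_box l N)%fset ->
  hamiltonian (c *: mon_basis R m) = (energy m N * c) *: mon_basis R m.
Proof.
move=> h0 mN; rewrite /hamiltonian /Hhat0 /Hhat.
under eq_bigr do rewrite (sum_varphi_dvarphi _ _ _ mN).
under [X in _ + X]eq_bigr => j _.
  have -> : \sum_(n \in [set: nat]) varphi R j n * dvarphi j n (c *: mon_basis R m)
    = \sum_(n \in [set: nat]) 1 *: (varphi R j n * dvarphi j n (c *: mon_basis R m)).
    by apply: eq_fsbigr => n _; rewrite scale1r.
  rewrite (sum_varphi_dvarphi _ _ _ mN) !scalerA.
  over.
etransitivity.
  exact: (@scale_affine_combination R[i] (state_space R l) l.+1 (- (beta / hbart))
    hbar hbart (fun j => \sum_(0 <= n < N) (m (j, n))%:R * n%:R * c)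
    (fun j => lambda j * hbart * \sum_(0 <= n < N) (m (j, n))%:R * 1 * c)
    (mon_basis R m)).
apply: (congr1 (fun z => z *: mon_basis R m)).
rewrite /energy mulr_suml !mulr_sumr -big_split /= mulr_sumr; apply: eq_bigr => j _.
rewrite mulr_suml !mulr_sumr -big_split /= mulr_sumr; apply: eq_bigr => n _.
by field.
Qed.

Lemma iter_hamiltonian_mon m N k : hbart != 0 ->
  (finsupp m `<=` var_box l N)%fset ->
  iter k hamiltonian (mon_basis R m) = energy m N ^+ k *: mon_basis R m.
Proof.
move=> h0 mN; elim: k => [|k IH]; first by rewrite expr0 [RHS]scale1r.
rewrite iterS IH (hamiltonian_mon _ h0 mN) exprS.
reflexivity.
Qed.

(** The partial sums of the operator series at [m] are [exp_sum (energy m N)]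
    times [m]; [op_exp] selects their limit because coefficientwise limits are
    unique. *)
Lemma boltzmann_mon m N : hbart != 0 -> (finsupp m `<=` var_box l N)%fset ->
  boltzmann hbart beta hbar lambda (mon_basis R m) =
  expC (energy m N) *: mon_basis R m.
Proof.
move=> h0 mN; set e := energy m N.
have lim_e m' : ((series (fun k =>
      coef m' ((k`!%:R)^-1 *: iter k hamiltonian (mon_basis R m)) : R[i]^o)) @ \oo
      --> (coef m' (expC e *: mon_basis R m) : R[i]^o))%classic.
  have -> : series (fun k =>
      coef m' ((k`!%:R)^-1 *: iter k hamiltonian (mon_basis R m)) : R[i]^o) =
      (fun n => exp_sum e n * coef m' (mon_basis R m)).
    apply/funext => n; rewrite /series /= /exp_sum mulr_suml.
    apply: eq_bigr => k _.
    by rewrite (iter_hamiltonian_mon _ h0 mN) scalerA /coef mcoeffZ -/e [_ / _]mulrC.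
  rewrite /coef mcoeffZ; apply: (@cvgM R[i]); first exact: cvg_exp_sum.
  exact: cvg_cst.
apply: xget_unique => // g g_lim; apply/malgP => m'.
exact: (cvg_unique (@norm_hausdorff _ R[i]^o) (g_lim m') (lim_e m')).
Qed.

Lemma diag_coef_boltzmann m : hbart != 0 ->
  diag_coef (boltzmann hbart beta hbar lambda) m =
  monomial_value (fun i : var_index l =>
    expC (- (beta * lambda i.1)) * expC (- (beta * hbar)) ^+ i.2) m.
Proof.
move=> h0; have [N mN] := var_box_exhaust (finsupp m).
rewrite /diag_coef (boltzmann_mon h0 mN) /coef mcoeffZ mcoeffU eqxx mulr1n mulr1.
rewrite (monomial_valueE _ mN) prod_var_box /energy expC_sum.
apply: eq_bigr => j _; rewrite expC_sum; apply: eq_bigr => n _.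
by rewrite expC_natmul expCD expC_natmul.
Qed.

End Spectrum.

(** * The partition function *)

Theorem proposition3p1 (R : realType) (l : nat)
    (hbart beta hbar : R[i]) (lambda : 'I_l.+1 -> R[i]) :
  let q := expC (- (beta * hbar)) in
  let t := fun j => expC (- (beta * lambda j)) in
  hbart != 0 ->
  `|q| < 1 ->
  (forall j, `|t j| < 1) ->
  has_trace (boltzmann hbart beta hbar lambda) /\
  partition_function hbart beta hbar lambda = \prod_(j < l.+1) Gamma_q q (t j).
Proof.
move=> q t h0; rewrite (normc_ltC q 1) => q1 t1'.
have t1 j : normc (t j) < 1 by rewrite -(normc_ltC (t j) 1).
pose x (i : var_index l) := t i.1 * q ^+ i.2.
suff lim_tr : (
    partial_sum (diag_coef (boltzmann hbart beta hbar lambda)) @ totally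
    --> (\prod_(j < l.+1) Gamma_q q (t j) : R[i]^o))%classic.
  have FF := @totally_filter (monom l).
  split; first by apply/cvg_ex; eexists; exact: lim_tr.
  exact: (cvg_lim (@norm_hausdorff _ R[i]^o) lim_tr).
rewrite (_ : diag_coef _ = monomial_value x); last first.
  by apply/funext => m; exact: diag_coef_boltzmann.
apply: (@cvg_sum_monomial_value R _ x (@var_box l) _ _ _ _
  (\prod_(j < l.+1) expR (normc (t j) / (1 - normc (t j)) * (1 - normc q)^-1))).
- by move=> i; exact: normc_geometric_lt1.
- exact: var_box_mono.
- exact: var_box_exhaust.
- under eq_fun do rewrite prod_var_box.
  by apply: (@cvg_prod_seq R[i]) => j; exact: cvg_Gamma_q.
- move=> N; rewrite prod_var_box; apply: ler_prod => j _.
  apply/andP; split; last exact: (normc_q_product_bounded N q1 (t1 j)).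
  apply: prodr_ge0 => k _.
  by rewrite invr_ge0 subr_ge0 ltW // normc_geometric_lt1.
Qed.
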